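(* Let $t$ be a positive integer and let $(G,\sigma)$ be a signed graph with no negative loop and with no $\tilde K_t$-minor. Then $\chi_{fb}(G,\sigma)\leq 2t-2$.
   Context: A signed graph $(G,\sigma)$ is a graph (loops and parallel edges allowed) with a signature $\sigma:E(G)\to\{+,-\}$. Switching at a vertex multiplies the signs of all incident edges by $-$. A signed graph $(H,\pi)$ is a minor of $(G,\sigma)$ if it is obtained by a sequence of vertex deletions, edge deletions, contractions of positive edges, and switchings. For a graph $K$, $\tilde K$ is obtained by replacing every edge of $K$ by a positive and a negative parallel edge. A vertex set is balanced if it induces no negative cycle (sign of a cycle = product of its edge signs). A fractional balanced coloring of $(G,\sigma)$ assigns non-negative weights to the balanced sets of $(G,\sigma)$ such that every vertex lies in balanced sets of total weight at least $1$; the fractional balanced chromatic number $\chi_{fb}(G,\sigma)$ is the infimum of the total weight over all fractional balanced colorings. *)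

(* Defs.v *)
From HB Require Import structures.
From mathcomp Require Import all_boot all_order all_algebra.
From mathcomp Require Import boolp classical_sets reals.
Set Implicit Arguments. Unset Strict Implicit. Unset Printing Implicit Defensive.
Import Order.TTheory GRing.Theory Num.Theory.

(* A finite signed graph, loops and parallel edges allowed.
   Each edge e has (unordered) endpoints given as an ordered pair sends e;
   sneg e = true  iff  the sign of e is '-'. *)
Record sgraph := SGraph {
  sV : finType;
  sE : finType;
  sends : sE -> sV * sV;
  sneg : sE -> bool }.

Section Ops.
Variable G : sgraph.

Definition delv_V (v : sV G) : finType := {x : sV G | x != v}.
Definition delv_E (v : sV G) : finType :=
  {f : sE G | ((sends f).1 != v) && ((sends f).2 != v)}.
Definition delv_ends (v : sV G) (f : delv_E v) : delv_V v * delv_V v :=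
  (exist _ (sends (val f)).1 (proj1 (andP (valP f))),
   exist _ (sends (val f)).2 (proj2 (andP (valP f)))).
Definition delv (v : sV G) : sgraph :=
  @SGraph (delv_V v) (delv_E v) (@delv_ends v) (fun f => sneg (val f)).

Definition dele_E (e : sE G) : finType := {f : sE G | f != e}.
Definition dele (e : sE G) : sgraph :=
  @SGraph (sV G) (dele_E e) (fun f => sends (val f)) (fun f => sneg (val f)).

(* contraction of edge e with ends (u,w): w is identified with u and e is
   removed (for a loop, nothing is identified, i.e. contraction = deletion) *)
Definition contr_P (e : sE G) (x : sV G) : bool :=
  (x != (sends e).2) || ((sends e).1 == (sends e).2).
Definition contr_V (e : sE G) : finType := {x : sV G | contr_P e x}.
Lemma contr_map_proof (e : sE G) (x : sV G) :
  contr_P e (if x == (sends e).2 then (sends e).1 else x).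
Proof.
rewrite /contr_P; case H: (x == (sends e).2).
  by case: ((sends e).1 == (sends e).2); rewrite ?orbT.
by rewrite H.
Qed.
Definition contr_map (e : sE G) (x : sV G) : contr_V e :=
  exist (contr_P e) _ (contr_map_proof e x).
Definition contr (e : sE G) : sgraph :=
  @SGraph (contr_V e) (dele_E e)
    (fun f => (contr_map e (sends (val f)).1, contr_map e (sends (val f)).2))
    (fun f => sneg (val f)).

(* switching at v: sigma'(e) = tau(x) sigma(e) tau(y) for e with ends x,y *)
Definition switch (v : sV G) : sgraph :=
  @SGraph (sV G) (sE G) (@sends G)
    (fun e => sneg e (+) ((sends e).1 == v) (+) ((sends e).2 == v)).
End Ops.

Definition siso (G H : sgraph) : Prop :=
  exists (fV : sV G -> sV H) (fE : sE G -> sE H),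
    [/\ bijective fV, bijective fE &
      forall e, sneg (fE e) = sneg e /\
        (sends (fE e) = (fV (sends e).1, fV (sends e).2) \/
         sends (fE e) = (fV (sends e).2, fV (sends e).1))].

Inductive minor (G : sgraph) : sgraph -> Prop :=
| minor_refl : minor G G
| minor_iso H K : minor G H -> siso H K -> minor G K
| minor_delv H v : minor G H -> minor G (@delv H v)
| minor_dele H e : minor G H -> minor G (@dele H e)
| minor_contr H e : minor G H -> ~~ sneg e -> minor G (@contr H e)
| minor_switch H v : minor G H -> minor G (@switch H v).

(* K~_t : complete graph on t vertices, each edge doubled into a positive
   and a negative parallel edge *)
Definition Kt_E (t : nat) : finType :=
  {x : 'I_t * 'I_t * bool | (x.1.1 < x.1.2)%N}.
Definition Ktilde (t : nat) : sgraph :=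
  @SGraph ('I_t) (Kt_E t) (fun x => (val x).1) (fun x => (val x).2).

Definition is_cycle (G : sgraph) (vs : seq (sV G)) (es : seq (sE G)) : Prop :=
  [/\ (0 < size vs)%N, size es = size vs, uniq vs, uniq es &
    forall i, (i < size vs)%N -> forall x0 : sV G, forall e0 : sE G,
      let a := nth x0 vs i in
      let b := nth x0 vs ((i.+1) %% size vs) in
      let ep := sends (nth e0 es i) in
      ep = (a, b) \/ ep = (b, a)].

Definition negative_cycle (G : sgraph) (es : seq (sE G)) : bool :=
  odd (count (@sneg G) es).

Definition balanced (G : sgraph) (X : {set sV G}) : Prop :=
  ~ exists vs es, [/\ is_cycle vs es, all (fun v => v \in X) vs &
                      negative_cycle es].

Definition no_negative_loop (G : sgraph) : Prop :=
  forall e : sE G, (sends e).1 = (sends e).2 -> ~~ sneg e.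

Local Open Scope ring_scope.

Definition balb (G : sgraph) (X : {set sV G}) : bool := `[< balanced X >].

Definition frac_bcoloring (R : realType) (G : sgraph) (w : {set sV G} -> R) : Prop :=
  (forall B, balb B -> 0 <= w B) /\
  (forall v : sV G, 1 <= \sum_(B : {set sV G} | balb B && (v \in B)) w B).

Definition fb_weight (R : realType) (G : sgraph) (w : {set sV G} -> R) : R :=
  \sum_(B : {set sV G} | balb B) w B.

Definition chi_fb (R : realType) (G : sgraph) : R :=
  inf [set x : R | exists w : {set sV G} -> R, frac_bcoloring w /\ x = fb_weight w].

(* Main.v *)
(** If a non-loop edge [e] has no parallel edge of the opposite sign, switch so
    that [e] is positive and contract it: balanced sets of [G / e] pull back to
    balanced sets of [G], and no negative loop is created. Hence one may assume
    that every edge is doubled with both signs, and the claim becomes the theorem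
    of Reed and Seymour that a graph without a [K_t] minor is fractionally
    [2(t-1)]-colourable.

    Its weighted form asks for a set of at least half of the total weight that is
    [(t-1)]-colourable. It is obtained by cutting off connected parts one at a
    time: in a connected remainder [C], the previous parts adjacent to [C] are
    pairwise adjacent, so there are at most [t-2] of them and a colour is free;
    the new part is a maximal connected subset of [C] adjacent to all of them in
    which some stable set has half of the weight. Such a subset exists: take a
    minimal connected [X] in [C] adjacent to all of them. Each non-cut vertex [v]
    of [X] is the only contact of [X] with some previous part [Y], and the
    maximality of [Y] yields [2 w(S) < w(P)] for every connected [P] in [X] through
    [v] and every stable [S] in [P - v]. So in a connected bipartite subset of [X]
    all non-cut vertices of [X] lie on the same side, which forces [X] itself to be
    bipartite.

    The fractional colouring comes from the weighted form by repeatedly picking a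
    heavy balanced set for the current coverage deficits, whose sum of squares
    grows only linearly. *)

Require Import Defs.
From mathcomp Require Import all_boot all_order all_algebra.
From mathcomp Require Import boolp zify lra.
Import Order.TTheory GRing.Theory Num.Theory.
Set Implicit Arguments. Unset Strict Implicit. Unset Printing Implicit Defensive.

(** * Connected sets, stable sets and vertex weights in a simple graph *)

Section SimpleGraph.
Variables (T : finType) (adj : rel T).
Hypotheses (adjC : symmetric adj) (adjN : irreflexive adj).

(** Connectivity is phrased through cuts. The empty set counts as connected, so that [set0] can
    later stand for the part of a free colour. *)
Definition conn (A : {set T}) : Prop := forall B : {set T},
  B \subset A -> B != set0 -> B != A ->
  exists x y, [/\ x \in B, y \in A, y \notin B & adj x y].

Definition touch (A B : {set T}) : bool := [exists x in A, exists y in B, adj x y].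

Definition stable (S : {set T}) : Prop := {in S &, forall x y, ~~ adj x y}.

Lemma touchP (A B : {set T}) :
  reflect (exists x y, [/\ x \in A, y \in B & adj x y]) (touch A B).
Proof.
apply: (iffP exists_inP) => [[x xA /exists_inP[y yB xy]]|[x [y [xA yB xy]]]].
  by exists x, y.
by exists x => //; apply/exists_inP; exists y.
Qed.

Lemma conn1 x : conn [set x].
Proof. by move=> B; rewrite subset1 => /orP[/eqP->|->//]; rewrite eqxx. Qed.

Lemma conn0 : conn set0.
Proof. by move=> B; rewrite subset0 => ->. Qed.

(** A cut [Z] of the union that no edge crosses contains or avoids each of [A] and [B]; the link
    between [x] and [y] forbids a different behaviour on the two. *)
Lemma connU (A B : {set T}) x y : conn A -> conn B ->
  x \in A -> y \in B -> (x == y) || adj x y -> conn (A :|: B).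
Proof.
move=> cA cB xA yB xy Z ZAB Z0 ZN.
have key D : conn D -> D \subset A :|: B ->
    (exists u v, [/\ u \in Z, v \in A :|: B, v \notin Z & adj u v]) \/
    (D \subset Z) \/ [disjoint D & Z].
  move=> cD DAB; case: (boolP (D \subset Z)) => [|DZ]; first by right; left.
  case: (boolP [disjoint D & Z]) => [|DZ0]; first by right; right.
  left; have [||| u [v [uI vD vI uv]]] := cD (D :&: Z).
  - exact: subsetIl.
  - by rewrite setI_eq0.
  - by apply: contra DZ => /eqP/setIidPl.
  exists u, v; move: uI vI; rewrite !inE vD /= => /andP[_ uZ] vZ; split=> //.
  by have := subsetP DAB _ vD; rewrite inE.
case: (key A cA (subsetUl _ _)) => [//|[AZ|AZ]];
case: (key B cB (subsetUr _ _)) => [//|[BZ|BZ]].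
- by move: ZN; rewrite eqEsubset ZAB subUset AZ BZ.
- exists x, y; have yZ : y \notin Z by rewrite (disjointFr BZ yB).
  split=> //; [exact: (subsetP AZ)|by rewrite inE yB orbT|].
  by case/orP: xy => // /eqP xy; rewrite -xy (subsetP AZ) in yZ.
- exists y, x; have xZ : x \notin Z by rewrite (disjointFr AZ xA).
  split=> //; [exact: (subsetP BZ)|by rewrite inE xA|].
  by case/orP: xy => [/eqP xy|]; [rewrite xy (subsetP BZ) in xZ|rewrite adjC].
- case/set0Pn: Z0 => z zZ; have := subsetP ZAB _ zZ; rewrite inE.
  by rewrite (disjointFl AZ zZ) (disjointFl BZ zZ).
Qed.

Lemma not_conn_split (A : {set T}) : ~ conn A -> exists B : {set T},
  [/\ B \subset A, B != set0, B != A & {in B & A :\: B, forall x y, ~~ adj x y}].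
Proof.
move=> nA; apply: contrapT => nE; apply: nA => B BA B0 BNA.
apply: contrapT => nxy; apply: nE; exists B; split=> // x y xB.
rewrite inE => /andP[yB yA]; apply/negP => xy; apply: nxy.
by exists x, y.
Qed.

Variable w : T -> nat.
Definition wt (A : {set T}) : nat := \sum_(x in A) w x.

Lemma wtU (A B : {set T}) : [disjoint A & B] -> wt (A :|: B) = wt A + wt B.
Proof. by move=> dAB; rewrite /wt -bigU //=; apply: eq_bigl => x; rewrite inE. Qed.

Lemma wt_split (A : {set T}) (p : pred T) :
  wt A = wt [set x in A | p x] + wt [set x in A | ~~ p x].
Proof.
rewrite /wt (bigID p) /=; congr (_ + _); apply: eq_bigl => x; rewrite !inE //.
Qed.

Definition half (X : {set T}) : Prop :=
  exists S : {set T}, [/\ S \subset X, stable S & wt X <= 2 * wt S].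

Lemma half_bipartite (X : {set T}) (h : T -> bool) :
  {in X &, forall x y, adj x y -> h x != h y} -> half X.
Proof.
move=> hP; have stab b : stable [set x in X | h x == b].
  move=> x y; rewrite !inE => /andP[xX /eqP hx] /andP[yX /eqP hy].
  by apply/negP => /(hP _ _ xX yX); rewrite hx hy eqxx.
have := wt_split X (fun x => h x == true).
rewrite (_ : [set x in X | h x != true] = [set x in X | h x == false]); last first.
  by apply/setP => x; rewrite !inE; case: (h x).
set A := [set x in X | _]; set B := [set x in X | _] => E.
have [AB|AB] := leqP (wt B) (wt A).
  by exists A; split; [apply/subsetP => x; rewrite inE => /andP[]|exact: stab|lia].
by exists B; split; [apply/subsetP => x; rewrite inE => /andP[]|exact: stab|lia].
Qed.

(** * Two-colouring a connected set through its non-cut vertices *)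

Section Bipartite.
Variable X : {set T}.
Hypothesis connX : conn X.
Hypothesis light : forall v, v \in X -> conn (X :\ v) ->
  forall P S : {set T}, P \subset X -> conn P -> v \in P ->
  S \subset P -> v \notin S -> stable S -> 2 * wt S < wt P.

Definition proper2 (P : {set T}) (g : T -> bool) :=
  {in P &, forall x y, adj x y -> g x != g y}.

(** If [u] and [v] lay on opposite sides, each side of [P] would miss one of them, so by [light]
    each would weigh less than half of [P], although together they make up [P]. *)
Lemma noncut_same_side (P : {set T}) (g : T -> bool) u v :
  P \subset X -> conn P -> proper2 P g ->
  u \in P -> conn (X :\ u) -> v \in P -> conn (X :\ v) -> g u = g v.
Proof.
move=> PX cP gP uP cu vP cv; apply/eqP; apply/negPn/negP => guv.
pose side b := [set x in P | g x == b].
have sideS b : side b \subset P by apply/subsetP => x; rewrite inE => /andP[].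
have stab b : stable (side b).
  move=> x y; rewrite !inE => /andP[xX /eqP hx] /andP[yX /eqP hy].
  by apply/negP => /(gP _ _ xX yX); rewrite hx hy eqxx.
have h1 : 2 * wt (side (g v)) < wt P.
  by apply: (light (subsetP PX _ uP)) => //; rewrite inE uP.
have h2 : 2 * wt (side (g u)) < wt P.
  by apply: (light (subsetP PX _ vP)) => //; rewrite inE vP eq_sym.
have := wt_split P (fun x => g x == g v).
rewrite (_ : [set x in P | g x != g v] = side (g u)) -/(side _); first by lia.
by apply/setP => x; rewrite !inE; move: guv; case: (g x) (g u) (g v) => [] [] [].
Qed.

(* [D] is a union of components of [X - a]. *)
Definition lobe (a : T) (D : {set T}) : Prop :=
  [/\ D \subset X, a \notin D & {in D & X, forall x y, adj x y -> y \in a |: D}].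

(* A connected bipartite piece hanging from [a] into the lobe [D] and reaching a
   non-cut vertex of [X]; [p] is the side of that vertex relative to [a]. *)
Definition tail (a : T) (D : {set T}) (p : bool) : Prop :=
  exists (Q : {set T}) (g : T -> bool) (v : T), [/\ [/\ a \in Q, Q \subset a |: D & conn Q],
    proper2 Q g, g a = false & [/\ v \in Q, conn (X :\ v) & g v = p]].

Lemma cut_lobes a : a \in X -> ~ conn (X :\ a) -> exists A B : {set T},
  [/\ lobe a A, lobe a B, A != set0, B != set0 & [disjoint A & B]].
Proof.
move=> aX /not_conn_split [A [AX A0 AN Aadj]]; exists A, ((X :\ a) :\: A).
split=> //.
- split; first by apply: subset_trans AX (subsetDl _ _).
    by apply/negP => /(subsetP AX); rewrite !inE eqxx.
  move=> x y xA yX xy; rewrite !inE; apply/norP => -[ya yA].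
  by have := Aadj x y xA; rewrite !inE ya yA yX xy => /(_ isT).
- split; first by apply: subset_trans (subsetDl _ _) (subsetDl _ _).
    by rewrite !inE eqxx andbF.
  move=> x y xB yX xy; rewrite !inE yX andbT.
  case: (eqVneq y a) => //= ya; rewrite andbT; apply/negP => yA.
  by have := Aadj y x yA xB; rewrite adjC xy.
- apply: contra AN; rewrite setD_eq0 => ?; by rewrite eqEsubset AX.
- by rewrite disjoints_subset setDE setCI setCK subsetU// subxx orbT.
Qed.

(** Let [b] be a neighbour of [a] in [D]. If [b] is a non-cut vertex, the edge is a tail. Otherwise
    some lobe at [b] avoids [a] and is smaller than [D]; a tail found there is extended by [a]. *)
Lemma lobe_tail a D : a \in X -> lobe a D -> D != set0 -> exists p, tail a D p.
Proof.
have [n] := ubnP #|D|; elim: n => // n IHn in a D * => Dn aX [DX aD Dadj] D0.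
have [||| b [y [bD yX yD by_]]] := connX (B := D) => //.
  by apply: contra aD => /eqP->.
have ? : y = a by have := Dadj _ _ bD yX by_; rewrite !inE (negPf yD) orbF => /eqP.
subst y; have bX := subsetP DX _ bD.
have ab : b != a by apply: contraTneq bD => ->.
have [cb|ncb] := pselect (conn (X :\ b)).
  exists true, [set a; b], (fun x => x == b), b; split.
  - split; first by rewrite !inE eqxx.
      by rewrite setUS// sub1set.
    by apply: (connU (@conn1 a) (@conn1 b) (set11 a) (set11 b)); rewrite adjC by_ orbT.
  - move=> x z; rewrite !inE => /orP[]/eqP-> /orP[]/eqP->; rewrite ?adjN // eqxx;
    by rewrite ?(eq_sym a) (negPf ab).
  - by rewrite eq_sym (negPf ab).
  - by rewrite !inE eqxx orbT.
have [D' [[D'X bD' D'adj] aD' D'0]] : exists D', [/\ lobe b D', a \notin D' & D' != set0].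
  have [A [B [lA lB A0 B0 AB]]] := cut_lobes bX ncb.
  case: (boolP (a \in A)) => aA; last by exists A.
  by exists B; split=> //; rewrite (disjointFr AB aA).
(* Since [X] is connected, an edge leaves [D' :\: D]. It ends in [b] or in [D'], hence in [D], so it
   starts at [a], which is not in [D']. *)
have D'D : D' \subset D.
  rewrite -setD_eq0; apply/negPn/negP => Z0.
  have [||| z [y [zZ yX' yZ zy]]] := connX (B := D' :\: D) => //.
  - by apply: subset_trans (subsetDl _ _) D'X.
  - by apply: contraNneq aD' => E; have : a \in D' :\: D by [rewrite E]; rewrite inE => /andP[].
  move: zZ; rewrite inE => /andP[zD zD'].
  have zX := subsetP D'X _ zD'.
  suff yD' : y \in D.
    have := Dadj _ _ yD' zX; rewrite adjC zy => /(_ isT).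
    by rewrite !inE (negPf zD) orbF => /eqP za; rewrite za (negPf aD') in zD'.
  have := D'adj _ _ zD' yX' zy; rewrite !inE => /orP[/eqP->//|yD'].
  by move: yZ; rewrite inE yD' andbT negbK.
have [p [Q [g [v [[bQ QD cQ] gP gb [vQ cv gv]]]]]] : exists p, tail b D' p.
  apply: IHn => //.
  have : D' \proper D by apply/properP; split=> //; exists b.
  by move/proper_card => /leq_trans; apply; rewrite -ltnS.
have QD2 : Q \subset D.
  by apply: subset_trans QD _; rewrite subUset sub1set bD.
have aQ : a \notin Q by apply: contra aD => /(subsetP QD2).
have aonly z : z \in Q -> adj a z -> z = b.
  move=> zQ az; have := subsetP QD _ zQ; rewrite !inE => /orP[/eqP//|zD'].
  have := D'adj _ _ zD' aX; rewrite adjC az => /(_ isT).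
  by rewrite !inE (negPf aD') eq_sym (negPf ab).
(* The colours are flipped on [Q]: its only neighbour of [a] is [b], which had colour false and must
   now differ from [a]. *)
exists (~~ p), (a |: Q), (fun x => (x != a) && ~~ g x), v; split.
- split; first by rewrite !inE eqxx.
    exact: setUS.
  by apply: (connU (@conn1 a) cQ (set11 a) bQ); rewrite adjC by_ orbT.
- move=> x z; rewrite !inE => /orP[/eqP->|xQ] /orP[/eqP->|zQ]; rewrite ?adjN //.
  + by move=> /(aonly _ zQ) ->; rewrite eqxx ab gb.
  + by rewrite adjC => /(aonly _ xQ) ->; rewrite eqxx ab gb.
  + move=> /(gP _ _ xQ zQ).
    by rewrite (memPn aQ _ xQ) (memPn aQ _ zQ) /=; case: (g x) (g z) => [] [].
- by rewrite eqxx.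
- by split; rewrite // ?(memPn aQ _ vQ) ?gv // inE vQ orbT.
Qed.

(** The tails share only [a], where both colourings are false, and no edge joins the two lobes. The
    colourings therefore glue, and [noncut_same_side] compares the two end vertices. *)
Lemma tails_at_vertex a A B p q : a \in X -> lobe a A -> lobe a B ->
  [disjoint A & B] -> tail a A p -> tail a B q -> p = q.
Proof.
move=> aX [AX aA Aadj] [BX aB Badj] AB.
move=> [P [f [u [[aP PA cP] fP fa [uP cu <-]]]]] [Q [g [v [[aQ QB cQ] gP ga [vQ cv <-]]]]].
pose h x := if x \in P then f x else g x.
have hQ x : x \in Q -> h x = g x.
  move=> xQ; rewrite /h; case: ifP => // xP.
  have := subsetP PA _ xP; have := subsetP QB _ xQ; rewrite !inE.
  case/orP=> [/eqP->|xB]; first by rewrite fa ga.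
  case/orP=> [/eqP->|xA]; first by rewrite fa ga.
  by rewrite (disjointFr AB xA) in xB.
have hP x : x \in P -> h x = f x by rewrite /h => ->.
have PX : P \subset X by apply: subset_trans PA _; rewrite subUset sub1set aX.
have QX : Q \subset X by apply: subset_trans QB _; rewrite subUset sub1set aX.
have mix x y : x \in P -> y \in Q -> adj x y -> h x != h y.
  move=> xP yQ xy; case: (boolP (y \in P)) => yP.
    by rewrite !hP //; apply: fP.
  have := subsetP PA _ xP; rewrite !inE => /orP[/eqP xa|xA].
    by subst x; rewrite !hQ //; apply: gP.
  have := Aadj _ _ xA (subsetP QX _ yQ) xy; have := subsetP QB _ yQ; rewrite !inE.
  move=> /orP[/eqP ya|yB]; first by rewrite ya aP in yP.
  move=> /orP[/eqP ya|yA]; first by rewrite ya aP in yP.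
  by rewrite (disjointFr AB yA) in yB.
rewrite -(hP _ uP) -(hQ _ vQ); apply: (@noncut_same_side (P :|: Q)) => //.
- by rewrite subUset PX.
- by apply: (connU cP cQ aP aQ); rewrite eqxx.
- move=> x y; rewrite !inE => /orP[xP|xQ] /orP[yP|yQ].
  + by rewrite !hP //; apply: fP.
  + exact: mix.
  + by rewrite adjC eq_sym; apply: mix.
  + by rewrite !hQ //; apply: gP.
- by rewrite inE uP.
- by rewrite inE vQ orbT.
Qed.

(** The tails are glued along the edge [a b] after flipping the second colouring, whence the
    negation. *)
Lemma tails_at_edge a b A B p q : a \in X -> b \in X -> adj a b ->
  lobe a A -> lobe b B -> b \notin A -> a \notin B ->
  tail a A p -> tail b B q -> p = ~~ q.
Proof.
move=> aX bX ab [AX aA Aadj] [BX bB Badj] bA aB.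
have ab' : a != b by apply: contraTneq ab => ->; rewrite adjN.
move=> [P [f [u [[aP PA cP] fP fa [uP cu <-]]]]] [Q [g [v [[bQ QB cQ] gP gb [vQ cv <-]]]]].
(* Otherwise no edge of the connected set [X] could leave [A :&: B]: its end would lie in both
   [a |: A] and [b |: B], hence in the intersection again. *)
have AB : [disjoint A & B].
  rewrite -setI_eq0; apply/negPn/negP => Z0.
  have [||| z [y [zZ yX yZ zy]]] := connX (B := A :&: B) => //.
  - by apply: subset_trans (subsetIl _ _) AX.
  - apply: contraNneq aA => E; suff : a \in A :&: B by rewrite inE => /andP[].
    by rewrite E.
  move: zZ yZ; rewrite !inE => /andP[zA zB].
  have := Aadj _ _ zA yX zy; have := Badj _ _ zB yX zy; rewrite !inE.
  case/orP=> [/eqP->|yB]; first by rewrite (negPf bA) eq_sym (negPf ab').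
  case/orP=> [/eqP ya|yA]; last by rewrite yA yB.
  by rewrite ya (negPf aB) in yB.
have PX : P \subset X by apply: subset_trans PA _; rewrite subUset sub1set aX.
have QX : Q \subset X by apply: subset_trans QB _; rewrite subUset sub1set bX.
have PQ x : x \in P -> x \in Q -> False.
  move=> /(subsetP PA) + /(subsetP QB); rewrite !inE.
  case/orP=> [/eqP->|xA]; first by rewrite (negPf ab') (negPf aB).
  case/orP=> [/eqP xb|xB]; first by rewrite -xb xA in bA.
  by rewrite (disjointFr AB xA) in xB.
pose h x := if x \in P then f x else ~~ g x.
have hP x : x \in P -> h x = f x by rewrite /h => ->.
have hQ x : x \in Q -> h x = ~~ g x.
  by move=> xQ; rewrite /h; case: ifP => // /PQ/(_ xQ).
have mix x y : x \in P -> y \in Q -> adj x y -> h x != h y.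
  move=> xP yQ xy; rewrite (hP _ xP) (hQ _ yQ).
  have yX := subsetP QX _ yQ; have xX := subsetP PX _ xP.
  have := subsetP PA _ xP; rewrite !inE => /orP[/eqP xa|xA].
    subst x; have := subsetP QB _ yQ; rewrite !inE => /orP[/eqP->|yB].
      by rewrite fa gb.
    have := Badj _ _ yB aX; rewrite adjC xy => /(_ isT).
    by rewrite !inE (negPf ab') (negPf aB).
  have := Aadj _ _ xA yX xy; rewrite !inE => /orP[/eqP ya|yA].
    by have := PQ _ aP; rewrite -ya => /(_ yQ).
  have := subsetP QB _ yQ; rewrite !inE => /orP[/eqP yb|yB].
    by rewrite -yb yA in bA.
  by rewrite (disjointFr AB yA) in yB.
rewrite -(hP _ uP) -(hQ _ vQ); apply: (@noncut_same_side (P :|: Q)) => //.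
- by rewrite subUset PX.
- by apply: (connU cP cQ aP bQ); rewrite ab orbT.
- move=> x y; rewrite !inE => /orP[xP|xQ] /orP[yP|yQ].
  + by rewrite !hP //; apply: fP.
  + exact: mix.
  + by rewrite adjC eq_sym; apply: mix.
  + by rewrite !hQ //; move=> /(gP _ _ xQ yQ); case: (g x) (g y) => [] [].
- by rewrite inE uP.
- by rewrite inE vQ orbT.
Qed.

(** At a cut vertex two disjoint lobes carry tails of equal side, and one of them misses [b]. At a
    non-cut vertex the empty lobe serves, with the tail reduced to [a]. *)
Lemma vertex_parity a : a \in X -> exists p, forall b, b != a ->
  exists D, [/\ lobe a D, b \notin D & tail a D p].
Proof.
move=> aX; have [ca|nca] := pselect (conn (X :\ a)).
  exists false => b _; exists set0; rewrite inE; split=> //.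
    by split; rewrite ?sub0set ?inE // => x y; rewrite inE.
  exists [set a], (fun=> false), a; split; rewrite ?inE //.
    by split; rewrite ?set11 ?subsetUl //; apply: conn1.
  by move=> x y; rewrite !inE => /eqP-> /eqP->; rewrite adjN.
have [A [B [lA lB A0 B0 AB]]] := cut_lobes aX nca.
have [p tA] := lobe_tail aX lA A0; have [q tB] := lobe_tail aX lB B0.
have pq := tails_at_vertex aX lA lB AB tA tB; subst q.
exists p => b _; case: (boolP (b \in A)) => bA; last by exists A.
by exists B; rewrite (disjointFr AB bA).
Qed.

(** The parities of the vertices form a proper two-colouring, because [tails_at_edge] flips them
    along every edge. *)
Lemma bipartite_half : half X.
Proof.
have /choice[h hP] : forall a, exists p, a \in X -> forall b, b != a ->
    exists D, [/\ lobe a D, b \notin D & tail a D p].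
  move=> a; case: (boolP (a \in X)) => aX; last by exists true.
  by have [p pP] := vertex_parity aX; exists p.
apply: (half_bipartite (h := h)) => a b aX bX ab.
have ab' : a != b by apply: contraTneq ab => ->; rewrite adjN.
have ba' : b != a by rewrite eq_sym.
have [A [lA bA tA]] := hP a aX b ba'.
have [B [lB aB tB]] := hP b bX a ab'.
by rewrite (tails_at_edge aX bX ab lA lB bA aB tA tB); case: (h b).
Qed.

End Bipartite.

(** * Branch sets of a clique minor, and parts that cannot be enlarged *)

Definition clique_model t (f : T -> option 'I_t) : Prop :=
  [/\ forall i, exists x, f x = Some i,
      forall i, conn [set x | f x == Some i] &
      forall i j, i != j -> exists x y, [/\ f x = Some i, f y = Some j & adj x y]].

(* What is left of the maximality of a part [Y] having a stable half: gluing [P]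
   to [Y] and [S] to the stable half of [Y] must not give a larger such part. *)
Definition saturated (Y C : {set T}) : Prop := forall P S : {set T},
  P \subset C -> conn P -> touch P Y -> S \subset P -> stable S ->
  {in S & Y, forall x y, ~~ adj x y} -> 2 * wt S < wt P.

Lemma saturatedS (Y C D : {set T}) :
  D \subset C -> saturated Y C -> saturated Y D.
Proof. by move=> DC sat P S PD; apply: sat; apply: subset_trans DC. Qed.

Lemma exists_saturated_part (I : finType) (C : {set T}) (Y : I -> {set T}) :
  C != set0 -> conn C -> (forall i, touch C (Y i)) ->
  (forall i, saturated (Y i) C) ->
  exists X : {set T}, [/\ X \subset C, X != set0 & conn X] /\
    [/\ half X, forall i, touch X (Y i) & saturated X (C :\: X)].
Proof.
move=> C0 cC tC sat.
pose ok (X : {set T}) := `[< [/\ X \subset C, X != set0, conn X & forall i, touch X (Y i)] >].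
(* Two extremal choices: a minimal [M] has a stable half, and a maximal [X] above it among the sets
   with a stable half is saturated. *)
have [|M /minsetP[okM minM] MC] := @minset_exists _ ok C.
  by apply/asboolP.
have [_ M0 cM tM] := asboolP _ okM.
have halfM : half M.
  have [[x xE]|nM1] := pselect (exists x, M = [set x]).
    exists M; split=> //; last by lia.
    by rewrite xE => y z; rewrite !inE => /eqP-> /eqP->; rewrite adjN.
  apply: bipartite_half => // v vM cv P S PM cP vP SP vS stS.
  (* By minimality, deleting [v] loses some [Y i]. So [v] is the only contact with it, [P] touches
     it through [v], and [S], which avoids [v], does not. *)
  have [i ni] : exists i, ~~ touch (M :\ v) (Y i).
    apply: contrapT => nE; have /minM : ok (M :\ v).
      apply/asboolP; split=> //.
      - by apply: subset_trans (subsetDl _ _) MC.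
      - apply: contra_notN nM1; rewrite setD_eq0 subset1 (negPf M0) orbF.
        by move=> /eqP; exists v.
      - by move=> i; case: (boolP (touch _ (Y i))) => // ni; case: nE; exists i.
    by move=> /(_ (subsetDl _ _)) E; rewrite -E !inE eqxx in vM.
  have only x y : x \in M -> y \in Y i -> adj x y -> x = v.
    move=> xM yY xy; apply/eqP; apply: contraNT ni => xv.
    by apply/touchP; exists x, y; rewrite !inE xv.
  have /touchP[x [y [xM yY xy]]] := tM i.
  have xv := only x y xM yY xy; apply: (sat i) => //.
  - exact: subset_trans PM MC.
  - by apply/touchP; exists v, y; rewrite -{2}xv.
  - move=> a b aS bY; apply/negP => /(only _ _ (subsetP PM _ (subsetP SP _ aS)) bY) av.
    by rewrite -av aS in vS.
pose ok' X := ok X && `[< half X >].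
have [|X /maxsetP[okX maxX] MX] := @maxset_exists _ ok' M.
  by rewrite /ok' okM; apply/asboolP.
have /andP[/asboolP[XC X0 cX tX] /asboolP halfX] := okX.
exists X; split=> //; split=> // P S PC cP tPX SP stS SX.
rewrite ltnNge; apply/negP => wP.
have /touchP[x [y [xP yX xy]]] := tPX.
have dPX : [disjoint P & X].
  rewrite disjoints_subset; apply/subsetP => z /(subsetP PC).
  by rewrite !inE => /andP[].
(* A violating pair would enlarge [X]: [S] together with the stable half of [X] is stable and has
   half of the weight of the union. *)
have /maxX : ok' (P :|: X).
  apply/andP; split; apply/asboolP.
    split.
    - by rewrite subUset XC (subset_trans PC) // subsetDl.
    - by apply/set0Pn; exists x; rewrite inE xP.
    - by apply: (connU cP cX xP yX); rewrite xy orbT.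
    - move=> i; have /touchP[u [v [uX vY uv]]] := tX i.
      by apply/touchP; exists u, v; rewrite inE uX orbT.
  have [S' [S'X stS' wS']] := halfX.
  exists (S :|: S'); split; first exact: setUSS.
  - move=> a b; rewrite !inE => /orP[aS|aS] /orP[bS|bS].
    + exact: stS.
    + by apply: SX => //; apply: (subsetP S'X).
    + by rewrite adjC; apply: SX => //; apply: (subsetP S'X).
    + exact: stS'.
  - rewrite !wtU //; last first.
      rewrite disjoints_subset; apply/subsetP => z /(subsetP SP) zP.
      by rewrite inE; apply/negP => /(subsetP S'X); rewrite (disjointFr dPX zP).
    by rewrite mulnDr leq_add.
move=> /(_ (subsetUr _ _)) E.
by have := disjointFr dPX xP; rewrite -E inE xP.
Qed.

(** * Colouring half of the weight with [k] colours *)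

Section Partition.
Variable k : nat.
Hypothesis no_model : ~ exists f : T -> option 'I_k.+1, clique_model f.

(** The remainder [C] is itself the last branch set, with index [ord_max]; the parts take the other
    indices through [lift]. *)
Lemma clique_model_of_parts (C : {set T}) (Y : 'I_k -> {set T}) :
  C != set0 -> conn C -> (forall c, conn (Y c)) -> (forall c, touch C (Y c)) ->
  (forall c, [disjoint Y c & C]) ->
  (forall c d, c != d -> [disjoint Y c & Y d]) ->
  (forall c d, c != d -> touch (Y c) (Y d)) -> False.
Proof.
move=> C0 cC cY tC dC dY tY; apply: no_model.
pose f x := if x \in C then Some ord_max
            else omap (lift ord_max) [pick c | x \in Y c].
have fC x : (f x == Some ord_max) = (x \in C).
  rewrite /f; case: ifP => // _; first by rewrite eqxx.
  case: pickP => //= c _.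
  by rewrite (inj_eq Some_inj) eq_sym (negPf (neq_lift _ _)).
have fY x c : (f x == Some (lift ord_max c)) = (x \in Y c).
  rewrite /f; case: ifP => xC.
    by rewrite (disjointFl (dC c) xC) (inj_eq Some_inj) (negPf (neq_lift _ _)).
  case: pickP => /= [d xd|->//]; rewrite (inj_eq Some_inj).
  rewrite (inj_eq (@lift_inj _ _)); case: eqVneq => [<-|dc]; first by rewrite xd.
  by rewrite (disjointFr (dY _ _ dc) xd).
exists f; split.
- move=> i; case: (unliftP ord_max i) => [c|] ->.
    have /touchP[x [y [_ yY _]]] := tC c.
    by exists y; apply/eqP; rewrite fY.
  by case/set0Pn: C0 => x xC; exists x; apply/eqP; rewrite fC.
- move=> i; case: (unliftP ord_max i) => [c|] ->.
    rewrite (_ : [set x | _] = Y c); first exact: cY.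
    by apply/setP => x; rewrite inE fY.
  rewrite (_ : [set x | _] = C); first exact: cC.
  by apply/setP => x; rewrite inE fC.
- move=> i j; case: (unliftP ord_max i) => [c|] ->; case: (unliftP ord_max j) => [d|] ->.
  + rewrite (inj_eq (@lift_inj _ _)) => /tY/touchP[x [y [xc yd xy]]].
    by exists x, y; split=> //; apply/eqP; rewrite fY.
  + have /touchP[x [y [xC yc xy]]] := tC c.
    by exists y, x; split; rewrite 1?adjC //; apply/eqP; rewrite ?fY ?fC.
  + have /touchP[x [y [xC yd xy]]] := tC d.
    by exists x, y; split => //; apply/eqP; rewrite ?fY ?fC.
  + by rewrite eqxx.
Qed.

(* [Y c] is the part of colour [c] still visible from [C]; [Y c = set0] means that
   the colour is free. *)
Lemma colored_half (C : {set T}) (Y : 'I_k -> {set T}) :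
  (forall c, conn (Y c)) -> (forall c, [disjoint Y c & C]) ->
  (forall c d, c != d -> [disjoint Y c & Y d]) ->
  (forall c d, c != d -> Y c != set0 -> Y d != set0 -> touch (Y c) (Y d)) ->
  (forall c, saturated (Y c) C) ->
  exists (S : {set T}) (col : T -> nat),
  [/\ S \subset C, wt C <= 2 * wt S, forall x, x \in S -> col x < k,
      {in S &, forall x y, adj x y -> col x != col y} &
      forall c, {in S & Y c, forall x y, adj x y -> col x != c}].
Proof.
have [n] := ubnP #|C|; elim: n => // n IHn in C Y * => Cn cY dC dY tY sat.
have [->|C0] := eqVneq C set0.
  exists set0, (fun=> 0); split; rewrite ?sub0set //.
  - by rewrite /wt big_set0.
  - by move=> x; rewrite inE.
  - by move=> x y; rewrite inE.
  - by move=> c x y; rewrite inE.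
have small (D : {set T}) : D \subset C -> D != C -> #|D| < n.
  move=> DC DNC; have : D \proper C by rewrite properEneq DNC.
  by move/proper_card => /leq_trans; apply; rewrite -ltnS.
have disjC (D : {set T}) c : D \subset C -> [disjoint Y c & D].
  by move=> DC; apply: disjointWr DC (dC c).
(* A disconnected remainder is split into two sides without edges between them, coloured
   independently. *)
have [cC|/not_conn_split[A [AC A0 AN Aadj]]] := pselect (conn C); last first.
  pose B := C :\: A; have BC : B \subset C by apply: subsetDl.
  have BN : B != C.
    apply: contra A0 => /eqP E; rewrite -subset0.
    apply/subsetP => x xA; have := subsetP AC _ xA.
    by rewrite -E inE xA.
  have dAB : [disjoint A & B].
    by rewrite disjoint_sym disjoints_subset; apply/subsetP => x; rewrite !inE => /andP[].
  have CE : C = A :|: B.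
    by apply/setP => x; rewrite !inE; case: (boolP (x \in A)) => // /(subsetP AC).
  have [||S1 [col1 [S1A w1 k1 p1 q1]]] := IHn A Y (small _ AC AN) cY _ dY tY _.
  - by move=> c; apply: disjC.
  - by move=> c; apply: saturatedS (sat c).
  have [||S2 [col2 [S2B w2 k2 p2 q2]]] := IHn B Y (small _ BC BN) cY _ dY tY _.
  - by move=> c; apply: disjC.
  - by move=> c; apply: saturatedS (sat c).
  have S2N x : x \in S2 -> x \in A = false.
    by move=> /(subsetP S2B); rewrite inE => /andP[/negPf].
  exists (S1 :|: S2), (fun x => if x \in A then col1 x else col2 x); split.
  - by rewrite CE setUSS.
  - rewrite [in wt C]CE !wtU ?mulnDr ?leq_add //.
    by apply: disjointWl S1A _; apply: disjointWr S2B _.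
  - move=> x; rewrite inE => /orP[xS|xS]; last by rewrite S2N // k2.
    by rewrite (subsetP S1A) // k1.
  - move=> x y; rewrite !inE => /orP[xS|xS] /orP[yS|yS]; rewrite ?(S2N _ xS) ?(S2N _ yS);
      rewrite ?(subsetP S1A _ xS) ?(subsetP S1A _ yS).
    + exact: p1.
    + by rewrite (negPf (Aadj _ _ (subsetP S1A _ xS) (subsetP S2B _ yS))).
    + by rewrite adjC (negPf (Aadj _ _ (subsetP S1A _ yS) (subsetP S2B _ xS))).
    + exact: p2.
  - move=> c x y; rewrite inE => /orP[xS|xS]; rewrite ?(S2N _ xS) ?(subsetP S1A _ xS).
      exact: q1.
    exact: q2.
(* A part out of contact with [C] is forgotten, which frees its colour for reuse. *)
pose Y1 c := if touch C (Y c) then Y c else set0.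
have Y1S c : Y1 c \subset Y c by rewrite /Y1; case: ifP; rewrite ?sub0set.
have dY1 c d : c != d -> [disjoint Y1 c & Y1 d].
  by move=> /dY cd; apply: disjointWl (Y1S c) _; apply: disjointWr (Y1S d) _.
have Y1n c : Y1 c != set0 -> touch C (Y c) /\ Y1 c = Y c.
  by rewrite /Y1; case: ifP => //; rewrite eqxx.
have cY1 c : conn (Y1 c) by rewrite /Y1; case: ifP => // _; apply: conn0.
have tY1 c d : c != d -> Y1 c != set0 -> Y1 d != set0 -> touch (Y1 c) (Y1 d).
  move=> cd c0 d0; have [_ cE] := Y1n _ c0; have [_ dE] := Y1n _ d0.
  by rewrite cE dE in c0 d0 *; apply: tY.
(* Were all [k] colours taken, the [k] parts and [C] would form a clique model with [k.+1] branch
   sets. *)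
have [c0 c0E] : exists c0, Y1 c0 = set0.
  apply: contrapT => nE.
  have Yn c : Y1 c != set0 by apply/negP => /eqP E; apply: nE; exists c.
  apply: (clique_model_of_parts C0 cC cY1) => //.
  - by move=> c; have [tc ->] := Y1n _ (Yn c).
  - by move=> c; apply: disjointWl (Y1S c) _.
  - by move=> c d cd; apply: tY1.
have [|| X [[XC X0 cX] [halfX tX satX]]] :=
  @exists_saturated_part {c | Y1 c != set0} C (fun c => Y1 (val c)) C0 cC.
- by move=> [c cn]; have [tc ->] := Y1n _ cn.
- by move=> [c cn]; have [_ /= ->] := Y1n _ cn.
pose Y2 c := if c == c0 then X else Y1 c.
have CXC : C :\: X \subset C by apply: subsetDl.
have CXN : C :\: X != C.
  apply: contra X0 => /eqP E; rewrite -subset0.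
  by apply/subsetP => x xX; have := subsetP XC _ xX; rewrite -E inE xX.
have dX c : [disjoint Y1 c & X].
  by apply: disjointWl (Y1S c) _; apply: disjC.
have [||||| S [col [SC wS kS pS qS]]] := IHn (C :\: X) Y2 (small _ CXC CXN).
- by move=> c; rewrite /Y2; case: ifP.
- move=> c; rewrite /Y2; case: ifP => _.
    by rewrite disjoint_sym disjoints_subset; apply/subsetP => x; rewrite !inE => /andP[].
  by apply: disjointWl (Y1S c) _; apply: disjC.
- move=> c d; rewrite /Y2; case: (eqVneq c c0) => [->|cc] cd; case: (eqVneq d c0) => [dd|dd].
  + by rewrite dd eqxx in cd.
  + by rewrite disjoint_sym.
  + exact: dX.
  + exact: dY1.
- move=> c d; rewrite /Y2; case: (eqVneq c c0) => [->|cc] cd; case: (eqVneq d c0) => [dd|dd] h1 h2.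
  + by rewrite dd eqxx in cd.
  + exact: (tX (exist _ d h2)).
  + have /touchP[x [y [xX yY xy]]] := tX (exist _ c h1).
    by apply/touchP; exists y, x; rewrite adjC.
  + exact: tY1.
- move=> c; rewrite /Y2; case: ifP => // _; apply: saturatedS CXC _.
  rewrite /Y1; case: ifP => // _ P S PC cP /touchP[x [y [_]]].
  by rewrite inE.
have [S' [S'X stS' wS']] := halfX.
have SN x : x \in S -> x \in X = false.
  by move=> /(subsetP SC); rewrite inE => /andP[/negPf].
have xc0 x y : x \in S -> y \in X -> adj x y -> col x != c0.
  by move=> xS yX; apply: (qS c0) => //; rewrite /Y2 eqxx.
exists (S' :|: S), (fun x => if x \in X then c0 : nat else col x); split.
- by rewrite subUset (subset_trans S'X XC) (subset_trans SC CXC).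
- have -> : C = X :|: (C :\: X).
    by apply/setP => x; rewrite !inE; case: (boolP (x \in X)) => // /(subsetP XC).
  rewrite !wtU ?mulnDr ?leq_add //.
    rewrite disjoints_subset; apply/subsetP => x /(subsetP S'X) xX; rewrite inE.
    by apply/negP => /SN; rewrite xX.
  by rewrite disjoints_subset; apply/subsetP => x xX; rewrite !inE xX.
- by move=> x; rewrite inE => /orP[/(subsetP S'X)->//|xS]; rewrite SN // kS.
- move=> x y; rewrite !inE => /orP[xS|xS] /orP[yS|yS]; rewrite ?(SN _ xS) ?(SN _ yS);
    rewrite ?(subsetP S'X _ xS) ?(subsetP S'X _ yS).
  + by rewrite (negPf (stS' _ _ xS yS)).
  + by rewrite adjC eq_sym; apply: xc0 => //; apply: (subsetP S'X).
  + by apply: xc0 => //; apply: (subsetP S'X).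
  + exact: pS.
- move=> c x y xS yY xy; have xC : x \in C.
    by move: xS; rewrite inE => /orP[/(subsetP S'X)/(subsetP XC)|/(subsetP SC)/(subsetP CXC)].
  (* The edge [x y] shows that [Y c] still touches [C], so [c] is not the free colour given to
     [X]. *)
  have cE : Y1 c = Y c.
    by rewrite /Y1; case: ifP => // /negbT/negP[]; apply/touchP; exists x, y.
  have cc : c != c0.
    by apply: contraTneq yY => E; rewrite -cE E c0E inE.
  move: xS; rewrite inE => /orP[/(subsetP S'X)->|xS].
    by rewrite eq_sym; apply: contra cc => /eqP/val_inj->.
  by rewrite SN //; apply: (qS c) xy => //; rewrite /Y2 (negPf cc) cE.
Qed.

Lemma heavy_stable_set : exists2 S : {set T}, stable S &
  wt [set: T] <= 2 * k * wt S.
Proof.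
have [||||| S [col [_ wS kS pS _]]] := @colored_half [set: T] (fun=> set0).
- by move=> c; apply: conn0.
- by move=> c; rewrite disjoints_subset sub0set.
- by move=> c d _; rewrite disjoints_subset sub0set.
- by move=> c d _; rewrite eqxx.
- by move=> c P A _ _ /touchP[x [y []]]; rewrite inE.
have st0 : `[< stable set0 >] by apply/asboolP => x y; rewrite inE.
(* A stable set of maximum weight bounds each of the [k] colour classes of [S]. *)
have [M /asboolP stM maxM] := @arg_maxnP _ set0 (fun S => `[< stable S >]) wt st0.
exists M => //; apply: leq_trans wS _; rewrite -mulnA leq_mul2l /=.
have -> : wt S = \sum_(i < k) \sum_(x in S) (col x == i) * w x.
  rewrite exchange_big; apply: eq_bigr => x xS.
  rewrite (bigD1 (Ordinal (kS x xS))) //= eqxx mul1n big1 ?addn0 // => i ni.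
  case: eqVneq => // xi; case/eqP: ni; exact: val_inj.
rewrite -[k in leqRHS]card_ord -sum_nat_const; apply: leq_sum => i _.
rewrite (_ : \sum_(x in S) _ = wt [set x in S | col x == i]); last first.
  rewrite /wt [RHS](eq_bigl (fun x => (x \in S) && (col x == i))); last first.
    by move=> x; rewrite inE.
  by rewrite big_mkcondr; apply: eq_bigr => x _; case: eqP; rewrite ?mul1n.
apply: maxM; apply/asboolP => x y; rewrite !inE => /andP[xS /eqP xi] /andP[yS /eqP yi].
by apply/negP => /(pS _ _ xS yS); rewrite xi yi eqxx.
Qed.

End Partition.
End SimpleGraph.

(** * Minors of signed graphs and models of [Ktilde] *)

Lemma minor_trans (G H K : sgraph) : minor G H -> minor H K -> minor G K.
Proof.
move=> GH; elim=> [//|L M _ ih LM|L v _ ih|L e _ ih|L e _ ih pe|L v _ ih].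
- exact: minor_iso ih LM.
- exact: minor_delv.
- exact: minor_dele.
- exact: minor_contr.
- exact: minor_switch.
Qed.

Lemma card_sig_lt (T : finType) (P : pred T) x :
  ~~ P x -> #|{: {y | P y}}| < #|T|.
Proof.
move=> Px; rewrite card_sig; apply/proper_card/properP; split.
  exact: subset_predT.
by exists x.
Qed.

Definition joins (G : sgraph) (e : sE G) (x y : sV G) : bool :=
  (sends e == (x, y)) || (sends e == (y, x)).

Lemma joins_ends (G : sgraph) (e : sE G) : joins e (sends e).1 (sends e).2.
Proof. by rewrite /joins -surjective_pairing eqxx. Qed.

Lemma joinsC (G : sgraph) (e : sE G) x y : joins e x y = joins e y x.
Proof. by rewrite /joins orbC. Qed.

(** Edges outside the image of [h] are deleted one by one. Once [h] is onto, it is a bijection,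
    since an edge determines its sign and its ends ordered by [g]. *)
Lemma Ktilde_minor_of_edges t (G : sgraph) (g : sV G -> 'I_t)
    (h : Kt_E t -> sE G) :
  bijective g ->
  (forall x, sneg (h x) = (val x).2) ->
  (forall x, exists u v, [/\ joins (h x) u v, g u = (val x).1.1 & g v = (val x).1.2]) ->
  minor G (Ktilde t).
Proof.
have [n] := ubnP #|sE G|; elim: n => // n IHn in G g h * => Gn gbij hneg hends.
have [[e he]|hsurj] := pselect (exists e, forall x, h x != e).
  have := minor_dele e (minor_refl G) => /minor_trans; apply.
  apply: (IHn (dele e) g (fun x => exist _ (h x) (he x))) => //.
  by apply: leq_trans (_ : #|sE G| <= n); [apply: (@card_sig_lt _ _ e); rewrite eqxx|rewrite -ltnS].
have hinj : injective h.
  move=> p q E; apply: val_inj.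
  have [u [v [juv pu pv]]] := hends p; have [u' [v' [juv' qu qv]]] := hends q.
  have nb : (val p).2 = (val q).2 by rewrite -!hneg E.
  have lp : g u < g v by rewrite pu pv; apply: (valP p).
  have lq : g u' < g v' by rewrite qu qv; apply: (valP q).
  have [uu vv] : u = u' /\ v = v'.
    move: juv juv'; rewrite /joins E => /orP[]/eqP-> /orP[]/eqP[uE vE] //; subst u' v';
      by move: (ltn_trans lp lq); rewrite ltnn.
  subst u' v'; move: pu pv qu qv nb.
  by case: (val p) (val q) => [[i j] b] [[i' j'] b'] /= <- <- <- <- <-.
have /choice[h' h'K] : forall e, exists x, h x = e.
  move=> e; apply: contrapT => nE; apply: hsurj; exists e => x.
  by apply/eqP => E; apply: nE; exists x.
apply: minor_iso (minor_refl G) _; exists g, h'; split=> //.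
  by exists h => [e|x] //; apply: hinj.
move=> e /=; rewrite -hneg h'K; split=> //.
have [u [v [+ gu gv]]] := hends (h' e); rewrite h'K.
have uvE : (val (h' e)).1 = (g u, g v) by rewrite gu gv -surjective_pairing.
by case/orP=> /eqP->; [left|right].
Qed.

(** Branch sets are connected by positive edges, so they can be contracted without switching. *)
Definition sgraph_model t (G : sgraph) (f : sV G -> option 'I_t) : Prop :=
  [/\ forall i, exists x, f x = Some i,
      forall i (B : {set sV G}), B \subset [set x | f x == Some i] ->
        B != set0 -> B != [set x | f x == Some i] ->
        exists e x y, [/\ ~~ sneg e, joins e x y, x \in B, f y = Some i & y \notin B] &
      forall i j b, i != j -> exists e x y,
        [/\ sneg e = b, joins e x y, f x = Some i & f y = Some j]].

(** Vertices outside the branch sets are deleted and positive edges inside them contracted, until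
    [f] is a bijection onto the indices. *)
Lemma Ktilde_minor_of_model t (G : sgraph) (f : sV G -> option 'I_t) :
  sgraph_model f -> minor G (Ktilde t).
Proof.
have [n] := ubnP #|sV G|; elim: n => // n IHn in G f * => Gn [f1 f2 f3].
have [[v fv]|fS] := pselect (exists v, f v = None).
  have := minor_delv v (minor_refl G) => /minor_trans; apply.
  have keep x i : f x = Some i -> x != v by apply: contra_eqN => /eqP->; rewrite fv.
  have lift_edge e x y i j : joins e x y -> f x = Some i -> f y = Some j ->
      exists (e' : sE (delv v)) (x' y' : sV (delv v)),
      [/\ val e' = e, val x' = x, val y' = y & joins e' x' y'].
    move=> exy /keep xv /keep yv.
    have ev : ((sends e).1 != v) && ((sends e).2 != v).
      by case/orP: exy => /eqP->; rewrite /= xv yv.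
    exists (exist _ e ev), (exist _ x xv), (exist _ y yv); split=> //.
  apply: (IHn (delv v) (fun x => f (val x))).
    apply: leq_trans (_ : #|sV G| <= n); last by rewrite -ltnS.
    by apply: (@card_sig_lt _ _ v); rewrite eqxx.
  split.
  - by move=> i; have [x fx] := f1 i; exists (exist _ x (keep _ _ fx)).
  - move=> i B BS B0 BN.
    have [||| e [x [y [pe exy xB fy yB]]]] := f2 i (val @: B).
    + apply/subsetP => _ /imsetP[x xB ->]; have := subsetP BS _ xB.
      by rewrite !inE.
    + by case/set0Pn: B0 => x xB; apply/set0Pn; exists (val x); apply: imset_f.
    + apply: contra BN => /eqP E; apply/eqP/setP => x; rewrite inE.
      by rewrite -(mem_imset _ _ val_inj) E inE.
    have [x0 x0B xE] := imsetP xB.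
    have fx : f x = Some i by have := subsetP BS _ x0B; rewrite inE -xE => /eqP.
    have [e' [x' [y' [eE xE' yE exy']]]] := lift_edge _ _ _ _ _ exy fx fy.
    exists e', x', y'; split; rewrite //= ?eE ?yE //.
      by rewrite -(mem_imset _ _ val_inj) xE'.
    by rewrite -(mem_imset _ _ val_inj) yE.
  - move=> i j b /(f3 _ _ b)[e [x [y [eb exy fx fy]]]].
    have [e' [x' [y' [eE xE' yE exy']]]] := lift_edge _ _ _ _ _ exy fx fy.
    by exists e', x', y'; rewrite /= eE xE' yE.
have [[x [y [xy fxy]]]|finj] := pselect (exists x y, x != y /\ f x = f y).
  case fx: (f x) => [i|]; last by case: fS; exists x.
  have [||| e [x' [z [pe exz]]]] := f2 i [set x].
  - by rewrite sub1set inE fx.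
  - by apply/set0Pn; exists x; rewrite set11.
  - by apply/eqP => /setP/(_ y); rewrite !inE eq_sym (negPf xy) -fxy fx eqxx.
  rewrite !inE => /eqP xE fz zx; subst x'.
  have [fe ne] : f (sends e).1 = f (sends e).2 /\ (sends e).1 != (sends e).2.
    by case/orP: exz => /eqP->; rewrite /= fx fz eq_sym; split; rewrite // eq_sym.
  have := minor_contr (minor_refl G) pe => /minor_trans; apply.
  pose m := contr_map e.
  have fm a : f (val (m a)) = f a by rewrite /=; case: eqP => // ->.
  have mK (a : sV (contr e)) : m (val a) = a.
    apply: val_inj => /=; case: a => a /=; rewrite /contr_P (negPf ne) orbF.
    by case: eqP.
  have me : m (sends e).1 = m (sends e).2.
    by apply: val_inj; rewrite /= eqxx; case: eqP.
  have lift_edge e0 a b : joins e0 a b -> m a != m b ->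
      exists e' : sE (contr e), val e' = e0 /\ joins e' (m a) (m b).
    move=> eab mab; have ee : e0 != e.
      by apply: contra mab => /eqP E; case/orP: eab => /eqP; rewrite E => Ee;
        have := me; rewrite Ee /= => ->.
    exists (exist _ e0 ee); split=> //; rewrite /joins /=.
    by case/orP: eab => /eqP->; rewrite eqxx ?orbT.
  apply: (IHn (contr e) (fun a => f (val a))).
    apply: leq_trans (_ : #|sV G| <= n); last by rewrite -ltnS.
    by apply: (@card_sig_lt _ _ (sends e).2); rewrite /contr_P eqxx (negPf ne).
  split.
  - by move=> j; have [a fa] := f1 j; exists (m a); rewrite fm.
  - move=> j B BS B0 BN.
    have [||| e0 [a [b [pe0 eab aB fb bB]]]] := f2 j (m @^-1: B).
    + by apply/subsetP => a; rewrite !inE => /(subsetP BS); rewrite inE fm.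
    + by case/set0Pn: B0 => a aB; apply/set0Pn; exists (val a); rewrite inE mK.
    + apply: contra BN => /eqP E; apply/eqP/setP => a.
      by have /setP/(_ (val a)) := E; rewrite !inE mK.
    rewrite !inE in aB bB.
    have mab : m a != m b by apply: contraNneq bB => <-.
    have [e' [eE eab']] := lift_edge _ _ _ eab mab.
    by exists e', (m a), (m b); split; rewrite //= ?eE // -fb fm.
  - move=> j l c /[dup] jl /(f3 _ _ c)[e0 [a [b [ec eab fa fb]]]].
    have mab : m a != m b.
      apply: contraNneq jl => E; apply/eqP; apply: Some_inj.
      by rewrite -fa -fb -[f a]fm -[f b]fm E.
    have [e' [eE eab']] := lift_edge _ _ _ eab mab.
    by exists e', (m a), (m b); split; rewrite //= ?eE // -?fa -?fb fm.
have /choice[g gP] : forall x, exists i, f x = Some i.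
  by move=> x; case fx: (f x) => [i|]; [exists i|case: fS; exists x].
have ginj : injective g.
  move=> x y gxy; apply/eqP/negPn/negP => xy; case: finj.
  by exists x, y; rewrite !gP gxy.
have /choice[g' g'P] : forall i, exists x, g x = i.
  by move=> i; have [x fx] := f1 i; exists x; apply: Some_inj; rewrite -gP.
have /choice[h hP] : forall k : Kt_E t, exists e, exists x y,
    [/\ sneg e = (val k).2, joins e x y, f x = Some (val k).1.1 & f y = Some (val k).1.2].
  move=> [[[i j] b] /= ij]; apply: f3.
  by apply: contraTneq ij => ->; rewrite ltnn.
apply: (@Ktilde_minor_of_edges t G g h).
- by exists g' => [x|i]; [apply: ginj|]; rewrite g'P.
- by move=> k; have [x [y []]] := hP k.
- move=> k; have [x [y [_ jxy fx fy]]] := hP k; exists x, y.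
  by split=> //; apply: Some_inj; rewrite -gP.
Qed.

(** * Potentials as certificates of balance, and balanced sets of large weight *)

Definition has_potential (G : sgraph) (X : {set sV G}) : Prop :=
  exists tau : sV G -> bool, forall e : sE G,
    (sends e).1 \in X -> (sends e).2 \in X ->
    sneg e = tau (sends e).1 (+) tau (sends e).2.

(** Along a cycle the sign is a telescoping sum of values of [tau]: each vertex is counted twice. *)
Lemma has_potential_balanced (G : sgraph) (X : {set sV G}) :
  has_potential X -> balanced X.
Proof.
move=> [tau tauP] [vs [es [[vs0 eqs _ _ adjP] /allP vsX]]].
case: vs vs0 eqs adjP vsX => // v0 vs' _; set vs := v0 :: vs'.
case: es => // e0 es'; set es := e0 :: es' => eqs adjP vsX /negP[]; rewrite /negative_cycle.
have -> : odd (count (@sneg G) es) = \big[addb/false]_(e <- es) sneg e.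
  elim: es {eqs adjP} => [|e es ih]; first by rewrite big_nil.
  by rewrite big_cons /= oddD ih; case: (sneg e).
rewrite (big_nth e0) eqs big_mkord.
under eq_bigr => i _.
  have -> : sneg (nth e0 es i) = tau (nth v0 vs i) (+) tau (nth v0 vs (ordS i)).
    have iX := vsX _ (mem_nth v0 (ltn_ord i)).
    have jX := vsX _ (mem_nth v0 (ltn_ord (ordS i))).
    have := tauP (nth e0 es i).
    by case: (adjP i (ltn_ord i) v0 e0) => /= ->; move=> ->//; rewrite addbC.
  over.
rewrite big_split /= -(reindex_inj (@ordS_inj _) (P := xpredT)
  (F := fun i : 'I_(size vs) => tau (nth v0 vs i))) /=.
by rewrite addbb.
Qed.

Lemma has_potential_switch (G : sgraph) (v : sV G) (X : {set sV G}) :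
  @has_potential (switch v) X -> has_potential X.
Proof.
move=> [tau tauP]; exists (fun x => tau x (+) (x == v)) => e e1 e2.
have /= := tauP e e1 e2.
by case: (sneg e) (tau _) (tau _) (_ == v) (_ == v) => [] [] [] [] [].
Qed.

Lemma has_potential_contr (G : sgraph) (e : sE G) (X : {set sV (contr e)}) :
  ~~ sneg e -> has_potential X -> has_potential (contr_map e @^-1: X).
Proof.
move=> pe [tau tauP]; exists (fun x => tau (contr_map e x)) => e'; rewrite !inE => e1 e2.
have [->|ee] := eqVneq e' e; last exact: (tauP (exist _ e' ee)).
have -> : contr_map e (sends e).1 = contr_map e (sends e).2.
  by apply: val_inj; rewrite /= eqxx; case: eqP.
by rewrite addbb (negPf pe).
Qed.

Lemma no_negative_loop_switch (G : sgraph) (v : sV G) :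
  no_negative_loop G -> no_negative_loop (switch v).
Proof. by move=> nl e /= E; rewrite E addbK; apply: nl. Qed.

(** An edge becomes a loop only if it was a loop or joins the ends of [e]. *)
Lemma no_negative_loop_contr (G : sgraph) (e : sE G) :
  no_negative_loop G ->
  (forall e', joins e' (sends e).1 (sends e).2 -> ~~ sneg e') ->
  no_negative_loop (contr e).
Proof.
move=> nl npar [e' ee] /= /(congr1 val) /=.
case: eqVneq => [e1|_]; case: eqVneq => [e2|_] E.
- by apply: nl; rewrite e1 e2.
- by apply: npar; rewrite /joins -{2}e1 E -surjective_pairing eqxx orbT.
- by apply: npar; rewrite /joins -{1}e2 -E -surjective_pairing eqxx.
- exact: nl.
Qed.

(** Every adjacency of the underlying simple graph occurs with both signs, so a clique model there
    is a model of [Ktilde]. A stable set contains only positive loops, and a constant potential fits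
    it. *)
Lemma heavy_balanced_doubled (k : nat) (G : sgraph) (w : sV G -> nat) :
  no_negative_loop G -> ~ minor G (Ktilde k.+1) ->
  (forall e : sE G, (sends e).1 != (sends e).2 ->
    exists2 e', sneg e' = ~~ sneg e & joins e' (sends e).1 (sends e).2) ->
  exists2 X : {set sV G}, has_potential X &
    \sum_v w v <= 2 * k * \sum_(v in X) w v.
Proof.
move=> nl nm dbl.
pose adj x y := (x != y) && [exists e : sE G, joins e x y].
have adjC : symmetric adj.
  by move=> x y; rewrite /adj eq_sym; under eq_existsb do rewrite joinsC.
have adjN : irreflexive adj by move=> x; rewrite /adj eqxx.
have adj_sign x y b : adj x y -> exists2 e : sE G, sneg e = b & joins e x y.
  move=> /andP[xy /existsP[e exy]].
  have [eb|eb] := eqVneq (sneg e) b; first by exists e.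
  have ne : (sends e).1 != (sends e).2.
    by case/orP: exy => /eqP->; rewrite //= eq_sym.
  have [e' e'b e'e] := dbl e ne.
  exists e'; first by rewrite e'b; case: (sneg e) b eb => [] [].
  by case/orP: exy e'e => /eqP-> //=; rewrite joinsC.
have [[f [f1 f2 f3]]|nmodel] :=
    pselect (exists f : sV G -> option 'I_k.+1, clique_model adj f).
  case: nm; apply: (@Ktilde_minor_of_model _ _ f); split=> //.
  - move=> i B BS B0 BN; have [x [y [xB yS yB xy]]] := f2 i B BS B0 BN.
    have [e pe exy] := adj_sign x y false xy.
    by exists e, x, y; rewrite pe; split=> //; apply/eqP; move: yS; rewrite inE.
  - move=> i j b /f3[x [y [fx fy xy]]].
    by have [e eb exy] := adj_sign x y b xy; exists e, x, y.
have [S stS wS] := heavy_stable_set adjC adjN w nmodel.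
exists S; last by move: wS; rewrite /wt; under eq_bigl do rewrite inE.
exists (fun=> false) => e e1 e2; apply/negbTE.
have [/nl//|ne] := eqVneq (sends e).1 (sends e).2.
have := stS _ _ e1 e2; rewrite /adj ne => /existsPn/(_ e).
by rewrite joins_ends.
Qed.

Lemma heavy_balanced_set (k : nat) (G : sgraph) (w : sV G -> nat) :
  no_negative_loop G -> ~ minor G (Ktilde k.+1) ->
  exists2 X : {set sV G}, has_potential X &
    \sum_v w v <= 2 * k * \sum_(v in X) w v.
Proof.
have [n] := ubnP #|sV G|; elim: n => // n IHn in G w *.
(* The graph [H] is arbitrary because both [G] and a switching of [G] are contracted. Weights are
   added up over the fibres of the contraction. *)
have contract (H : sgraph) (u : sV H -> nat) (e : sE H) : #|sV H| <= n ->
    no_negative_loop H -> ~ minor H (Ktilde k.+1) ->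
    (sends e).1 != (sends e).2 ->
    (forall e', joins e' (sends e).1 (sends e).2 -> ~~ sneg e') ->
    exists2 X : {set sV H}, has_potential X &
      \sum_v u v <= 2 * k * \sum_(v in X) u v.
  move=> Hn nl nm ne npar; have pe := npar _ (joins_ends e).
  pose u' (y : sV (contr e)) := \sum_(x | contr_map e x == y) u x.
  have [||| X potX wX] := IHn (contr e) u'.
  - apply: leq_trans Hn.
    by apply: (@card_sig_lt _ _ (sends e).2); rewrite /contr_P eqxx (negPf ne).
  - exact: no_negative_loop_contr.
  - by move=> /(minor_trans (minor_contr (minor_refl H) pe)).
  exists (contr_map e @^-1: X); first exact: has_potential_contr.
  rewrite (partition_big (contr_map e) predT) //= (partition_big (contr_map e) (mem X)) /=.
    move: wX; congr (_ <= _ * _); apply: eq_bigr => y yX.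
    apply: eq_bigl => x; rewrite inE; case: eqP => [->|]; rewrite ?andbF //.
    by rewrite yX.
  by move=> x; rewrite inE.
rewrite ltnS => Gn nl nm.
have [[e [ne npar]]|dbl] := pselect (exists e : sE G, (sends e).1 != (sends e).2 /\
    forall e', joins e' (sends e).1 (sends e).2 -> sneg e' = sneg e); last first.
  apply: heavy_balanced_doubled => // e ne; apply: contrapT => nE; apply: dbl.
  exists e; split=> // e' e'e; apply/eqP; apply: contrapT => /negP ns.
  by apply: nE; exists e' => //; case: (sneg e') (sneg e) ns => [] [].
case se: (sneg e); last first.
  by apply: (contract G w e) => // e' /npar ->; rewrite se.
(* Switching at one end makes [e] and all its parallel edges positive. *)
have [|||| X potX wX] := contract (switch (sends e).1) w e Gn.
- exact: no_negative_loop_switch.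
- by move=> /(minor_trans (minor_switch (sends e).1 (minor_refl G))).
- by [].
- move=> e' /[dup] e'e /npar /= ->; rewrite se.
  by case/orP: e'e => /eqP-> /=; rewrite eqxx eq_sym (negPf ne).
by exists X => //; apply: has_potential_switch potX.
Qed.

(** * Near-covers from heavy sets, by a quadratic potential *)

Lemma deficit_step (m d d' : nat) (b : bool) : d' <= d.+1 - m * b ->
  d' ^ 2 + 2 * (m * (b * d)) <= d ^ 2 + 2 * d + m.+1 ^ 2.
(* The term [m.+1 ^ 2] absorbs the constants, also when the subtraction truncates to 0, where
   [2 * m * d] is at most [d ^ 2 + m ^ 2]. *)
Proof. by case: b; rewrite ?muln0 ?muln1 ?mul1n ?mul0n !expnS !expn0; nia. Qed.

Section Cover.
Variables (V : finType) (good : pred {set V}) (m : nat).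
Hypothesis heavy : forall w : V -> nat,
  exists2 X : {set V}, good X & \sum_v w v <= m * \sum_(v in X) w v.

Definition hits (s : seq {set V}) (v : V) : nat := count (fun X : {set V} => v \in X) s.

(** Each round adds a set that is heavy for the current deficits. Its cross term outweighs the
    linear growth of the squares, so only the constant [m.+1 ^ 2] per vertex remains. *)
Lemma small_deficits (N : nat) : exists s : seq {set V},
  [/\ size s = N, all good s &
      \sum_v (N - m * hits s v) ^ 2 <= #|V| * m.+1 ^ 2 * N].
Proof.
elim: N => [|N [s [sN gs ds]]].
  by exists [::]; split=> //; rewrite big1.
have [X gX wX] := heavy (fun v => N - m * hits s v).
exists (X :: s); split; rewrite /= ?sN ?gX //.
rewrite mulnS -(leq_add2r (2 * (m * \sum_(v in X) (N - m * hits s v)))).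
have : \sum_v ((N.+1 - m * hits (X :: s) v) ^ 2
         + 2 * (m * ((v \in X) * (N - m * hits s v)))) <=
       \sum_v ((N - m * hits s v) ^ 2 + 2 * (N - m * hits s v) + m.+1 ^ 2).
  apply: leq_sum => v _; apply: deficit_step.
  by rewrite /hits /=; case: (v \in X); lia.
have sum2 c (f g : V -> nat) : \sum_v (f v + c * g v) = \sum_v f v + c * \sum_v g v.
  by rewrite big_split big_distrr.
have sum3 c K (f g : V -> nat) :
    \sum_v (f v + c * g v + K) = \sum_v f v + c * \sum_v g v + #|V| * K.
  by rewrite big_split /= sum2 sum_nat_const.
rewrite sum2 sum3 -[\sum_v m * _]big_distrr /=.
have -> : \sum_v (v \in X) * (N - m * hits s v) = \sum_(v in X) (N - m * hits s v).
  by rewrite [RHS]big_mkcond; apply: eq_bigr => v _; case: (v \in X); rewrite ?mul1n.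
move=> /leq_trans; apply; move: ds wX.
set a := \sum_v _; set b := \sum_v _; set c := \sum_(v in X) _ ; set L := _ * _.
by lia.
Qed.

(** With [L * q ^ 2] rounds the sum of squares is at most [(L * q) ^ 2], so every single deficit is
    at most [L * q]. *)
Lemma near_cover (q : nat) : 0 < q -> exists s : seq {set V},
  [/\ size s = #|V| * m.+1 ^ 2 * q ^ 2, all good s &
      forall v, #|V| * m.+1 ^ 2 * q * q.-1 <= m * hits s v].
Proof.
move=> q0; set L := #|V| * m.+1 ^ 2.
have [s [sN gs ds]] := small_deficits (L * q ^ 2); exists s; split=> // v.
have : (L * q ^ 2 - m * hits s v) ^ 2 <= (L * q) ^ 2.
  apply: leq_trans (_ : L * (L * q ^ 2) <= _); last by rewrite expnMn; nia.
  by apply: leq_trans ds; rewrite (bigD1 v) //= leq_addr.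
rewrite leq_exp2r // => ?.
have -> : L * q * q.-1 = L * q ^ 2 - L * q.
  by rewrite -subn1 mulnBr muln1 expnS expn1 mulnA.
lia.
Qed.

End Cover.

(* From near-covers to the fractional balanced chromatic number *)
From mathcomp Require Import classical_sets reals.
Local Open Scope ring_scope.

Lemma chi_fb_le (R : realType) (G : sgraph) (w : {set sV G} -> R) :
  frac_bcoloring w -> chi_fb R G <= fb_weight w.
Proof.
move=> cw; apply: ge_inf; last by exists w.
exists 0 => _ [w' [[w0 _] ->]]; apply: sumr_ge0 => B; exact: w0.
Qed.

Lemma sum_count_mem (T : finType) (P : pred T) (s : seq T) :
  (\sum_(x | P x) count_mem x s = count P s)%N.
Proof.
elim: s => [|y s ih] /=; first by rewrite big1.
rewrite big_split /= ih; congr addn; case Py: (P y).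
  by rewrite (bigD1 y) //= eqxx big1 // => x /andP[_ /negPf]; rewrite eq_sym => ->.
by rewrite big1 // => x Px; case: eqP => // yx; rewrite yx Px in Py.
Qed.

Lemma chi_fb_le_heavy (R : realType) (G : sgraph) (m : nat) :
  (forall w : sV G -> nat, exists2 X : {set sV G}, balb X &
     (\sum_v w v <= m * \sum_(v in X) w v)%N) ->
  chi_fb R G <= m%:R.
Proof.
move=> heavy.
have [V0|Vn] := posnP #|sV G|.
  have /chi_fb_le/le_trans : frac_bcoloring (fun _ : {set sV G} => 0 : R).
    by split=> // v; have := card0_eq V0 v; rewrite inE.
  by apply; rewrite /fb_weight big1 ?ler0n.
have m0 : (0 < m)%N.
  have /card_gt0P[v _] := Vn; have [X _] := heavy (fun=> 1%N).
  by rewrite (bigD1 v) //=; case: (m) => //; rewrite mul0n.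
apply/ler_addgt0Pl => e e0.
(* The total weight will be [m * q / q.-1], that is [m + m / q.-1]; this choice gives
   [q.-1 > m / e], so the excess is at most [e]. *)
pose q := (Num.truncn (m%:R / e)).+2.
have [s [sN gs hs]] := near_cover heavy (isT : (0 < q)%N).
set L := (#|sV G| * m.+1 ^ 2)%N in sN hs.
have L0 : (0 < L)%N by rewrite muln_gt0 Vn expn_gt0.
clearbody L.
(* The lower bound on [m * hits s v] makes this weight per occurrence in [s] cover every vertex. *)
pose a : R := m%:R / (L * q * q.-1)%:R.
have a0 : 0 <= a by rewrite divr_ge0.
have D0 : 0 < (L * q * q.-1)%:R :> R by rewrite ltr0n !muln_gt0 L0.
pose w (B : {set sV G}) : R := (count_mem B s)%:R * a.
have wE (P : pred {set sV G}) : \sum_(B | P B) w B = (count P s)%:R * a.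
  by rewrite /w -mulr_suml -natr_sum sum_count_mem.
have /chi_fb_le/le_trans : frac_bcoloring w.
  split=> [B _|v]; first by rewrite mulr_ge0.
  rewrite wE (eq_in_count (a2 := fun B : {set sV G} => v \in B)); last first.
    by move=> B /(allP gs) ->.
  by rewrite /a mulrA ler_pdivlMr // mul1r -natrM ler_nat [leqRHS]mulnC; apply: hs.
apply; rewrite /fb_weight wE (eq_in_count (a2 := predT)); last first.
  by move=> B /(allP gs) ->.
rewrite count_predT sN /a mulrA ler_pdivrMr //.
have me : m%:R <= e * q.-1%:R.
  rewrite mulrC -ler_pdivrMr //; apply/ltW; apply: lt_le_trans (truncnS_gt _) _.
  by rewrite ler_nat.
have qE : q%:R = q.-1%:R + 1 :> R by rewrite natr1.
rewrite !natrM qE.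
(* This product is the difference of the two sides of the goal. *)
have : 0 <= L%:R * (q.-1%:R + 1) * (e * q.-1%:R - m%:R) :> R.
  by rewrite !mulr_ge0 ?subr_ge0 ?addr_ge0.
move: (L%:R) (q.-1%:R) (m%:R) => l p r; lra.
Qed.

Theorem theorem5p1 (R : realType) (t : nat) (G : sgraph) :
  (0 < t)%N ->
  no_negative_loop G ->
  ~ minor G (Ktilde t) ->
  chi_fb R G <= (2 * t - 2)%:R.
Proof.
case: t => // k _ nl nm; rewrite mulnS addKn.
apply: chi_fb_le_heavy => w; have [X potX wX] := heavy_balanced_set w nl nm.
by exists X => //; apply/asboolP/has_potential_balanced.
Qed.
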